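(* Let $m,r\ge1$ be integers, let $g(t)=\sum_{n\ge0}g_n\frac{t^n}{n!}$ be a formal power series with $g_0\ne0$, put $A(t)=1/g(t)$, and let ${}_{{}_LH^{(m,r)}}A_n(x,y,z)$ $(n\ge0)$ be the associated Laguerre-Gould Hopper based Appell polynomials. These polynomials are quasi-monomial with respect to the multiplicative operator $$\hat M_{LHA}=y+mD_x^{-1}\frac{\partial^{m-1}}{\partial y^{m-1}}+rz\frac{\partial^{r-1}}{\partial y^{r-1}}-\frac{g'(\partial_y)}{g(\partial_y)},$$ or, equivalently, $$\hat M_{LHA}=y+mD_x^{-1}\frac{\partial^{m-1}}{\partial y^{m-1}}+rz\frac{\partial^{r-1}}{\partial y^{r-1}}+\frac{A'(\partial_y)}{A(\partial_y)},$$ and the derivative operator $$\hat P_{LHA}=\partial_y,\qquad \partial_y:=\frac{\partial}{\partial y}.$$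
   Context: Coefficients are real (or complex) numbers. The Laguerre-Gould Hopper based Appell polynomials are defined by the formal generating function $$A(t)\,C_0(-xt^m)\exp(yt+zt^r)=\sum_{n=0}^{\infty}{}_{{}_LH^{(m,r)}}A_n(x,y,z)\frac{t^n}{n!},\qquad A(t)=\frac1{g(t)},$$ where $C_0(x)=\sum_{k\ge0}\frac{(-1)^kx^k}{(k!)^2}$ is the Bessel-Tricomi function of order zero. $D_x^{-1}$ is the inverse derivative operator acting on polynomials in $x$ (linearly over the other variables) by $D_x^{-1}\{x^k\}=\frac{x^{k+1}}{k+1}$. For a formal power series $f(t)=\sum_j f_jt^j$, $f(\partial_y)=\sum_j f_j\partial_y^j$ acts on polynomials in $y$ (a finite sum on each polynomial); $\frac{g'(\partial_y)}{g(\partial_y)}$ means $f(\partial_y)$ with $f=g'/g$, and similarly for $A'/A$. Here $y$ and $z$ in operators act by multiplication. A polynomial sequence $\{p_n\}_{n\ge0}$ is quasi-monomial with respect to a multiplicative operator $\hat M$ and a derivative operator $\hat P$ if $\hat M\{p_n\}=p_{n+1}$ for all $n\ge0$ and $\hat P\{p_n\}=n\,p_{n-1}$ for all $n\ge1$. *)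

(* Defs.v *)
From HB Require Import structures.
From mathcomp Require Import all_boot all_order all_algebra.
From mathcomp.multinomials Require Import freeg mpoly.

Set Implicit Arguments.
Unset Strict Implicit.
Unset Printing Implicit Defensive.

Import GRing.Theory Num.Theory.
Local Open Scope ring_scope.

(* A formal power series \sum_n f_n t^n is its coefficient sequence n |-> f_n. *)
Definition fps (S : Type) : Type := nat -> S.

Definition fps_one (S : nzRingType) : fps S := fun n => (n == 0%N)%:R.

Definition fps_mul (S : nzRingType) (f g : fps S) : fps S :=
  fun n => \sum_(i < n.+1) f i * g (n - i)%N.

Definition fps_exp (S : nzRingType) (f : fps S) (k : nat) : fps S :=
  iter k (fps_mul f) (fps_one S).

Definition fps_deriv (S : nzRingType) (f : fps S) : fps S :=
  fun n => f n.+1 *+ n.+1.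

(* The composition F(G(t)), meaningful when G 0 = 0: then the coefficient of
   t^n in G^k vanishes for k > n, so the sum below is the full one. *)
Definition fps_comp (K : nzRingType) (S : lalgType K) (F : fps K) (G : fps S)
  : fps S := fun n => \sum_(k < n.+1) F k *: fps_exp G k n.

(* The first n coefficients of 1 / f, from
   f_0 b_n = [n = 0] - \sum_(i < n) f_(n - i) b_i. *)
Fixpoint fps_inv_seq (K : fieldType) (f : fps K) (n : nat) : seq K :=
  if n is n'.+1 then
    let s := fps_inv_seq f n' in
    rcons s ((f 0%N)^-1 * ((n' == 0%N)%:R - \sum_(i < n') f (n' - i)%N * s`_i))
  else [::].

Definition fps_inv (K : fieldType) (f : fps K) : fps K :=
  fun n => (fps_inv_seq f n.+1)`_n.

Definition fps_div (K : fieldType) (f g : fps K) : fps K :=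
  fps_mul f (fps_inv g).

Lemma size_fps_inv_seq (K : fieldType) (f : fps K) n :
  size (fps_inv_seq f n) = n.
Proof. by elim: n => //= n IHn; rewrite size_rcons IHn. Qed.

Lemma nth_fps_inv_seq (K : fieldType) (f : fps K) n i :
  (i < n)%N -> (fps_inv_seq f n)`_i = fps_inv f i.
Proof.
elim: n => // n IHn; rewrite ltnS leq_eqVlt => /predU1P[-> // | lt_in].
by rewrite /= nth_rcons size_fps_inv_seq lt_in IHn.
Qed.

Lemma fps_mulV (K : fieldType) (f : fps K) :
  f 0%N != 0 -> fps_mul f (fps_inv f) =1 fps_one K.
Proof.
move=> f0 n; rewrite /fps_mul big_ord_recl /= subn0.
rewrite {1}/fps_inv /= nth_rcons size_fps_inv_seq ltnn eqxx.
rewrite mulrA divff // mul1r -addrA -[RHS]addr0; congr (_ + _).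
apply/eqP; rewrite addrC subr_eq0; apply/eqP.
rewrite (reindex_inj rev_ord_inj) /=; apply: eq_bigr => i _.
rewrite /bump add1n -subSn // subSS.
by rewrite subKn ?nth_fps_inv_seq // ltnW.
Qed.

Definition egf (K : fieldType) (a : nat -> K) : fps K :=
  fun n => a n / (n`!)%:R.

Definition exp_fps (K : fieldType) : fps K := fun k => (k`!)%:R^-1.

Definition bessel_tricomi0 (K : fieldType) : fps K :=
  fun k => (-1) ^+ k / ((k`!)%:R ^+ 2).

(* Polynomials in the variables x, y, z. *)
Definition ix : 'I_3 := @Ordinal 3 0 isT.
Definition iy : 'I_3 := @Ordinal 3 1 isT.
Definition iz : 'I_3 := @Ordinal 3 2 isT.

(* A(t) C_0(-x t^m) exp(y t + z t^r), for m, r >= 1. *)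
Definition LHA_gen (K : fieldType) (m r : nat) (A : fps K)
  : fps {mpoly K[3]} :=
  fps_mul
    (fps_mul
       (fun n => (A n)%:MP_[3])
       (fps_comp (@bessel_tricomi0 K)
          (fun n => if n == m then - 'X_ix else 0 : {mpoly K[3]})))
    (fps_comp (@exp_fps K)
       (fun n => (if n == 1%N then 'X_iy else 0)
                 + (if n == r then 'X_iz else 0) : {mpoly K[3]})).

Definition LHA (K : fieldType) (m r : nat) (A : fps K) (n : nat)
  : {mpoly K[3]} := (n`!)%:R *: LHA_gen m r A n.

Definition Dxinv (K : fieldType) (p : {mpoly K[3]}) : {mpoly K[3]} :=
  \sum_(a <- msupp p) (p@_a / (a ix).+1%:R) *: 'X_[(a + U_(ix))%MM].

Lemma DxinvX (K : fieldType) (a : 'X_{1..3}) :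
  Dxinv 'X_[K, a] = (a ix).+1%:R^-1 *: 'X_[(a + U_(ix))%MM].
Proof. by rewrite /Dxinv msuppX big_seq1 mcoeffX eqxx div1r. Qed.

(* f(d/dy) p; the derivatives of p of order >= msize p vanish, so the sum below
   is the full one (see fps_dyE). *)
Definition fps_dy (K : fieldType) (f : fps K) (p : {mpoly K[3]})
  : {mpoly K[3]} := \sum_(j < msize p) f j *: p^`M(iy, j).

Lemma fps_dyE (K : fieldType) (f : fps K) (p : {mpoly K[3]}) N :
  (msize p <= N)%N -> fps_dy f p = \sum_(j < N) f j *: p^`M(iy, j).
Proof.
move=> le_pN; rewrite /fps_dy.
rewrite (big_ord_widen _ (fun j => f j *: p^`M(iy, j)) le_pN).
rewrite [RHS](bigID (fun j : 'I_N => (j < msize p)%N)) /=.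
rewrite [X in _ = _ + X]big1 ?addr0 // => j; rewrite -leqNgt => le_pj.
rewrite mderivnE big_seq big1 ?scaler0 // => a a_p.
rewrite (@ffact_small (a iy)) ?mul0r ?scale0r //.
apply: leq_trans le_pj; apply: leq_ltn_trans (msize_mdeg_lt a_p).
by rewrite mdegE (bigD1 iy) //= leq_addr.
Qed.

Definition M_LHA_g (K : fieldType) (m r : nat) (g : fps K) (p : {mpoly K[3]})
  : {mpoly K[3]} :=
  'X_iy * p + Dxinv (p^`M(iy, m.-1)) *+ m + ('X_iz * p^`M(iy, r.-1)) *+ r
  - fps_dy (fps_div (fps_deriv g) g) p.

Definition M_LHA_A (K : fieldType) (m r : nat) (A : fps K) (p : {mpoly K[3]})
  : {mpoly K[3]} :=
  'X_iy * p + Dxinv (p^`M(iy, m.-1)) *+ m + ('X_iz * p^`M(iy, r.-1)) *+ r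
  + fps_dy (fps_div (fps_deriv A) A) p.

Definition P_LHA (K : fieldType) (p : {mpoly K[3]}) : {mpoly K[3]} :=
  p^`M(iy).

Definition quasi_monomial (V : zmodType) (p : nat -> V) (M P : V -> V) : Prop :=
  (forall n : nat, M (p n) = p n.+1)
  /\ (forall n : nat, (1 <= n)%N -> P (p n) = p n.-1 *+ n).

(* Main.v *)
(* Write Gen = A(t) B(t) E(t) with B = C_0(-x t^m) and E = exp(y t + z t^r).
   Since d/dy Gen = t Gen, one has f(d/dy) Gen = f(t) Gen for every power series
   f. The raising relation is then the identity for d/dt Gen given by the product
   rule: A' = (A'/A) A, E' = (y + r z t^(r-1)) E and B' = m t^(m-1) D_x^-1 B,
   where D_x^-1 commutes with multiplication by A and E, which are free of x. *)
Require Import Defs.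
From HB Require Import structures.
From mathcomp Require Import all_boot all_order all_algebra ring.
From mathcomp.multinomials Require Import freeg mpoly.
Local Open Scope ring_scope.

Import GRing.Theory Num.Theory.

Set Implicit Arguments.
Unset Strict Implicit.
Unset Printing Implicit Defensive.

(** * Ring laws for formal power series *)

Lemma fps_mulEtrunc (S : nzRingType) (f g : fps S) (N n : nat) :
  (n < N)%N -> fps_mul f g n = (\poly_(i < N) f i * \poly_(i < N) g i)`_n.
Proof.
move=> ltnN; rewrite coefM; apply: eq_bigr => i _.
rewrite !coef_poly (leq_ltn_trans _ ltnN) ?leq_ord //.
by rewrite (leq_ltn_trans _ ltnN) ?leq_subr.
Qed.

Lemma eq_fps_mul_upto (S : nzRingType) (f f' g g' : fps S) (n : nat) :
  (forall i, (i <= n)%N -> f i = f' i) -> (forall i, (i <= n)%N -> g i = g' i) ->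
  fps_mul f g n = fps_mul f' g' n.
Proof.
move=> eqf eqg; apply: eq_bigr => i _.
by rewrite eqf ?leq_ord // eqg ?leq_subr.
Qed.

Lemma eq_fps_mul (S : nzRingType) (f f' g g' : fps S) :
  f =1 f' -> g =1 g' -> fps_mul f g =1 fps_mul f' g'.
Proof. by move=> eqf eqg n; apply: eq_fps_mul_upto => i _; rewrite ?eqf ?eqg. Qed.

Lemma fps_mulC (S : comNzRingType) (f g : fps S) : fps_mul f g =1 fps_mul g f.
Proof. by move=> n; rewrite !(fps_mulEtrunc _ _ (ltnSn n)) mulrC. Qed.

(** Coefficient $n$ of a product involves only coefficients up to $n$, so associativity is inherited
    from polynomials truncated to degree at most $n$. *)
Lemma fps_mulA (S : nzRingType) (f g h : fps S) :
  fps_mul f (fps_mul g h) =1 fps_mul (fps_mul f g) h.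
Proof.
move=> n.
have trunc_mul u v i : (i <= n)%N ->
    fps_mul u v i = (\poly_(i < n.+1) u i * \poly_(i < n.+1) v i : {poly S})`_i.
  by move=> le_in; rewrite (fps_mulEtrunc u v (N := n.+1)).
transitivity (\poly_(i < n.+1) f i * (\poly_(i < n.+1) g i * \poly_(i < n.+1) h i))`_n.
  rewrite coefM; apply: eq_bigr => i _.
  by rewrite coef_poly ltn_ord trunc_mul ?leq_subr.
rewrite mulrA coefM; apply: eq_bigr => i _.
by rewrite coef_poly ltnS leq_subr trunc_mul ?leq_ord.
Qed.

Lemma fps_mulCA (S : comNzRingType) (f g h : fps S) :
  fps_mul f (fps_mul g h) =1 fps_mul g (fps_mul f h).
Proof.
move=> n; rewrite fps_mulA (eq_fps_mul (fps_mulC f g) (frefl h)).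
by rewrite fps_mulA.
Qed.

Lemma fps_mul1 (S : nzRingType) (f : fps S) : fps_mul (@fps_one S) f =1 f.
Proof.
move=> n; rewrite /fps_mul big_ord_recl /= /fps_one mul1r subn0 big1 ?addr0 //.
by move=> i _; rewrite mul0r.
Qed.

Lemma fps_mul0 (S : nzRingType) (f g : fps S) :
  f =1 (fun=> 0) -> fps_mul f g =1 (fun=> 0).
Proof. by move=> f0 n; rewrite /fps_mul big1 // => i _; rewrite f0 mul0r. Qed.

Lemma fps_mulr0 (S : nzRingType) (f g : fps S) :
  g =1 (fun=> 0) -> fps_mul f g =1 (fun=> 0).
Proof. by move=> g0 n; rewrite /fps_mul big1 // => i _; rewrite g0 mulr0. Qed.

Lemma fps_mulDl (S : nzRingType) (f g h : fps S) :
  fps_mul (fun n => f n + g n) h =1 (fun n => fps_mul f h n + fps_mul g h n).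
Proof.
by move=> n; rewrite -big_split; apply: eq_bigr => i _; rewrite mulrDl.
Qed.

(** The series $c t^j$, in a form convertible with the inner series of [LHA_gen], so that [LHA_genE]
    holds by conversion. *)
Definition fps_mono (S : nzRingType) (c : S) (j : nat) : fps S :=
  fun n => if n == j then c else 0.

Lemma fps_mul_mono (S : nzRingType) (c : S) (j : nat) (f : fps S) (n : nat) :
  fps_mul (fps_mono c j) f n = if (j <= n)%N then c * f (n - j)%N else 0.
Proof.
case: leqP => [le_jn | lt_nj].
  rewrite /fps_mul (bigD1 (inord j)) //= /fps_mono inordK ?ltnS // eqxx.
  rewrite big1 ?addr0 // => i /negPf ne_ij.
  by rewrite -(inj_eq val_inj) /= inordK ?ltnS // in ne_ij; rewrite ne_ij mul0r.
rewrite /fps_mul big1 // => i _; rewrite /fps_mono ifN ?mul0r //.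
by rewrite ltn_eqF // (leq_trans (ltn_ord i)).
Qed.

(** * Powers, composition and inverses *)

Lemma fps_exp_mono (S : nzRingType) (c : S) (j k n : nat) :
  fps_exp (fps_mono c j) k n = if n == (k * j)%N then c ^+ k else 0.
Proof.
elim: k n => [|k IHk] n /=; first by rewrite /fps_one; case: eqP.
rewrite fps_mul_mono IHk mulSn; case: leqP => [le_jn | lt_nj].
  by rewrite -(eqn_add2l j) subnKC //; case: eqP; rewrite ?mulr0 ?exprS.
by rewrite ltn_eqF // ltn_addr.
Qed.

Lemma fps_exp_small (S : nzRingType) (G : fps S) (k n : nat) :
  G 0%N = 0 -> (n < k)%N -> fps_exp G k n = 0.
Proof.
move=> G0; elim: k n => // k IHk n ltnk.
rewrite /= /fps_mul big1 // => -[[|i] lti] _ /=; first by rewrite G0 mul0r.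
rewrite IHk ?mulr0 //; rewrite ltnS in lti.
by rewrite -ltnS (leq_trans _ ltnk) // ltnS ltn_subrL (leq_ltn_trans _ lti).
Qed.

(** Powers $G^k$ with $k > n$ have no term of degree $n$. A bound shared by several coefficients
    lets derivations pass through the sum and sums be exchanged. *)
Lemma fps_comp_widen (K : nzRingType) (S : lalgType K) (F : fps K) (G : fps S)
    (N n : nat) :
  G 0%N = 0 -> (n < N)%N -> fps_comp F G n = \sum_(k < N) F k *: fps_exp G k n.
Proof.
move=> G0 ltnN; rewrite /fps_comp.
rewrite (big_ord_widen _ (fun k => F k *: fps_exp G k n) ltnN).
rewrite [RHS](bigID (fun k : 'I_N => (k < n.+1)%N)) /=.
rewrite [X in _ = _ + X]big1 ?addr0 // => k; rewrite -leqNgt => ltnk.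
by rewrite fps_exp_small ?scaler0.
Qed.

Lemma fps_divK (K : fieldType) (f g : fps K) :
  g 0%N != 0 -> fps_mul (fps_div f g) g =1 f.
Proof.
move=> g0 n; rewrite fps_mulC fps_mulCA.
by rewrite (eq_fps_mul (frefl f) (fps_mulV g0)) fps_mulC fps_mul1.
Qed.

Lemma fps_inv_neq0 (K : fieldType) (f : fps K) :
  f 0%N != 0 -> fps_inv f 0%N != 0.
Proof.
move=> f0; apply: contra_eq_neq (fps_mulV f0 0) => inv0.
by rewrite /fps_mul big_ord1 inv0 mulr0 eq_sym oner_neq0.
Qed.

Lemma fps_invK (K : fieldType) (f : fps K) :
  f 0%N != 0 -> fps_inv (fps_inv f) =1 f.
Proof.
move=> f0 n; have inv0 := fps_inv_neq0 f0.
(* Uniqueness of inverses: inserting $1 = f \cdot f^{-1}$ brings $f^{-1}$ next to its own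
   inverse. *)
rewrite -[LHS]fps_mul1 -(eq_fps_mul (fps_mulV f0) (frefl _)) -fps_mulA.
by rewrite (eq_fps_mul (frefl f) (fps_mulV inv0)) fps_mulC fps_mul1.
Qed.

(** * Derivations on power series *)

(* Covers both d/dt, which reads one coefficient further, and the derivations
   of S acting on coefficients. *)
Definition fps_derivation (K : nzRingType) (S : lalgType K)
    (D : fps S -> fps S) : Prop :=
  [/\ forall f g n, (forall i, (i <= n.+1)%N -> f i = g i) -> D f n = D g n,
      forall N (a : nat -> K) (F : nat -> fps S) n,
        D (fun i => \sum_(k < N) a k *: F k i) n = \sum_(k < N) a k *: D (F k) n
    & forall f g n, D (fps_mul f g) n = fps_mul (D f) g n + fps_mul f (D g) n].

Lemma fps_deriv_derivation (K : comNzRingType) (S : comAlgType K) :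
  fps_derivation (@fps_deriv S).
Proof.
split=> [f g n eqfg | N a F n | f g n].
- by rewrite /fps_deriv eqfg.
- by rewrite /fps_deriv -sumrMnl; apply: eq_bigr => k _; rewrite scalerMnr.
(* The Leibniz rule comes from polynomials; the truncation keeps coefficient $n+1$, which $d/dt$
   reads. *)
pose P (h : fps S) := \poly_(i < n.+2) h i.
have derivP h i : (i <= n)%N -> (P h)^`()`_i = fps_deriv h i.
  by move=> le_in; rewrite coef_deriv coef_poly !ltnS le_in.
have P_E h i : (i <= n)%N -> (P h)`_i = h i.
  by move=> le_in; rewrite coef_poly ltnS leqW.
rewrite {1}/fps_deriv (fps_mulEtrunc f g (ltnSn n.+1)) -coef_deriv derivM coefD !coefM.
by congr (_ + _); apply: eq_bigr => i _; rewrite derivP ?P_E // ?leq_ord ?leq_subr.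
Qed.

Lemma mderiv_derivation (K : comNzRingType) (n : nat) (i : 'I_n) :
  fps_derivation (fun (f : fps {mpoly K[n]}) k => (f k)^`M(i)).
Proof.
split=> [f g k -> // | N a F k | f g k].
  by rewrite raddf_sum; apply: eq_bigr => j _; rewrite /= mderivZ.
rewrite raddf_sum -big_split; apply: eq_bigr => j _; exact: mderivM.
Qed.

(** From $1 \cdot 1 = 1$ follows $D(1) = D(1) + D(1)$. *)
Lemma derivation_one (K : nzRingType) (S : lalgType K) (D : fps S -> fps S) :
  fps_derivation D -> D (@fps_one S) =1 (fun=> 0).
Proof.
case=> Dloc _ DM n; set u := @fps_one S.
have: D u n = D u n + fps_mul (D u) u n.
  have mulu1 : fps_mul u u =1 u by exact: fps_mul1.
  by rewrite -{1}(Dloc _ _ n (fun i _ => mulu1 i)) DM fps_mul1 addrC.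
(* [fps_mul1] is the left unit law only and [S] may be noncommutative, so the right one is
   computed. *)
have -> : fps_mul (D u) u n = D u n.
  rewrite /fps_mul big_ord_recr /= subnn mulr1 big1 ?add0r // => i _.
  by rewrite /u /fps_one subn_eq0 leqNgt ltn_ord mulr0.
by move/eqP; rewrite -subr_eq subrr eq_sym => /eqP.
Qed.

Lemma derivation_exp (K : comNzRingType) (S : comAlgType K)
    (D : fps S -> fps S) (G : fps S) (k n : nat) :
  fps_derivation D ->
  D (fps_exp G k.+1) n = fps_mul (D G) (fps_exp G k) n *+ k.+1.
Proof.
move=> derD; have [_ _ DM] := derD; elim: k n => [|k IHk] n.
  by rewrite DM (fps_mulr0 _ (derivation_one derD)) addr0.
rewrite [fps_exp G k.+2]/= DM mulrS; congr (_ + _).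
rewrite (eq_fps_mul (frefl G) IHk) /fps_mul.
under eq_bigr do rewrite mulrnAr.
rewrite sumrMnl -/(fps_mul _ (fps_mul _ _) _); congr (_ *+ _); exact: fps_mulCA.
Qed.

(** Termwise $D(G^{k+1})/(k+1)! = D(G)\,G^k/k!$. Serves both $d/dt$ and $\partial_y$. *)
Lemma derivation_comp_exp (K : numFieldType) (S : comAlgType K)
    (D : fps S -> fps S) (G : fps S) :
  fps_derivation D -> G 0%N = 0 ->
  D (fps_comp (@exp_fps K) G) =1 fps_mul (D G) (fps_comp (@exp_fps K) G).
Proof.
move=> derD G0 n; have [Dloc Dlin _] := derD.
(* [D] may read coefficient $n+1$, hence the common bound $n+2$; the term $k = 0$ then vanishes
   since $D(1) = 0$. *)
rewrite (Dloc _ (fun i => \sum_(k < n.+2) exp_fps K k *: fps_exp G k i)); last first.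
  by move=> i le_in; rewrite (fps_comp_widen _ _ (N := n.+2)).
rewrite Dlin big_ord_recl /= derivation_one // scaler0 add0r.
rewrite /fps_mul; under [RHS]eq_bigr => i _.
  rewrite (fps_comp_widen _ _ (N := n.+1)) ?ltnS ?leq_subr // mulr_sumr.
  under eq_bigr do rewrite -scalerAr.
  over.
rewrite exchange_big; apply: eq_bigr => k _.
rewrite -scaler_sumr -/(fps_mul (D G) (fps_exp G k) n) /bump /= add1n.
rewrite derivation_exp // -scaler_nat scalerA /exp_fps factS natrM invfM.
by rewrite mulrAC mulVf ?mul1r // pnatr_eq0.
Qed.

(** * The inverse derivative $D_x^{-1}$ *)

Lemma mcoeff_Dxinv (K : fieldType) (p : {mpoly K[3]}) (b : 'X_{1..3}) :
  (Dxinv p)@_b =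
  if b ix == 0%N then 0 else p@_(b - U_(ix))%MM / (b ix)%:R.
Proof.
rewrite /Dxinv raddf_sum /=.
under eq_bigr do rewrite mcoeffZ mcoeffX.
case: eqVneq => [b0 | b_neq0].
  rewrite big1 // => a _; case: eqP => [eq_ab | _]; last by rewrite mulr0.
  by move: b0; rewrite -eq_ab mnmDE mnm1E eqxx addn1.
have le_xb : (U_(ix) <= b)%MM.
  apply/mnm_lepP => j; rewrite mnm1E; case: eqVneq => // <-.
  by rewrite lt0n.
pose c := (b - U_(ix))%MM; have def_b : b = (c + U_(ix))%MM by rewrite submK.
rewrite -/c (eq_bigr (fun a => (p@_a / (a ix).+1%:R) * (a == c)%:R)); last first.
  by move=> a _; rewrite def_b eqm_add2r.
have -> : b ix = (c ix).+1 by rewrite def_b mnmDE mnm1E eqxx addn1.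
have [c_p | c_notp] := boolP (c \in msupp p).
  rewrite (bigD1_seq c) ?msupp_uniq //= eqxx mulr1 big1 ?addr0 // => a /negPf->.
  by rewrite mulr0.
rewrite memN_msupp_eq0 // mul0r big_seq big1 // => a a_p.
by case: eqP => [eq_ac | _]; rewrite ?mulr0 //; rewrite -eq_ac a_p in c_notp.
Qed.

(** The defining sum runs over the support of the argument, which is not additive; comparing
    coefficients avoids this. *)
Lemma Dxinv_is_linear (K : fieldType) : linear (@Dxinv K).
Proof.
move=> a p q; apply/mpolyP => b; rewrite mcoeffD mcoeffZ !mcoeff_Dxinv.
case: ifP => _; first by rewrite mulr0 addr0.
by rewrite mcoeffD mcoeffZ mulrDl mulrA.
Qed.

HB.instance Definition _ (K : fieldType) :=
  GRing.isLinear.Build K {mpoly K[3]} {mpoly K[3]} _ (@Dxinv K)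
    (@Dxinv_is_linear K).

(** On monomials, a variable other than $x$ leaves the exponent of $x$, hence the denominator,
    unchanged. *)
Lemma DxinvMX (K : fieldType) (i : 'I_3) (p : {mpoly K[3]}) :
  i != ix -> Dxinv ('X_i * p) = 'X_i * Dxinv p.
Proof.
move=> ne_ix; rewrite [p]mpolyE mulr_sumr !linear_sum mulr_sumr.
apply: eq_bigr => a _; rewrite -scalerAr !linearZ /= -scalerAr; congr (_ *: _).
rewrite -mpolyXD !DxinvX -scalerAr -mpolyXD mnmDE mnm1E (negPf ne_ix) add0n.
by rewrite addmA.
Qed.

(** Stands in for being free of $x$. Its closure properties carry it from the exponent $yt + zt^r$
    to its exponential. *)
Definition Dxinv_commutes (K : fieldType) (q : {mpoly K[3]}) : Prop :=
  forall p, Dxinv (q * p) = q * Dxinv p.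

Lemma Dxinv_commutesC (K : fieldType) (c : K) : Dxinv_commutes c%:MP_[3].
Proof. by move=> p; rewrite !mul_mpolyC linearZ. Qed.

Lemma Dxinv_commutesZ (K : fieldType) (c : K) (q : {mpoly K[3]}) :
  Dxinv_commutes q -> Dxinv_commutes (c *: q).
Proof. by move=> qDx p; rewrite -!scalerAl linearZ /= qDx. Qed.

Lemma Dxinv_commutes_sum (K : fieldType) (I : Type) (s : seq I) (P : pred I)
    (F : I -> {mpoly K[3]}) :
  (forall i, Dxinv_commutes (F i)) -> Dxinv_commutes (\sum_(i <- s | P i) F i).
Proof.
by move=> FDx p; rewrite !mulr_suml linear_sum; apply: eq_bigr => i _; apply: FDx.
Qed.

Lemma Dxinv_commutesM (K : fieldType) (q1 q2 : {mpoly K[3]}) :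
  Dxinv_commutes q1 -> Dxinv_commutes q2 -> Dxinv_commutes (q1 * q2).
Proof. by move=> q1Dx q2Dx p; rewrite -!mulrA q1Dx q2Dx. Qed.

Lemma Dxinv_commutes_comp (K : fieldType) (F : fps K) (G : fps {mpoly K[3]}) :
  (forall n, Dxinv_commutes (G n)) -> forall n, Dxinv_commutes (fps_comp F G n).
Proof.
move=> GDx n; apply: Dxinv_commutes_sum => k; apply: Dxinv_commutesZ.
move: (nat_of_ord k) => {k} k; elim: k n => [|k IHk] n /=.
  by rewrite /fps_one -mpolyC_nat; apply: Dxinv_commutesC.
by apply: Dxinv_commutes_sum => i; apply: Dxinv_commutesM.
Qed.

Lemma Dxinv_fps_mul (K : fieldType) (f g : fps {mpoly K[3]}) (n : nat) :
  (forall i, Dxinv_commutes (f i)) ->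
  Dxinv (fps_mul f g n) = fps_mul f (fun i => Dxinv (g i)) n.
Proof.
by move=> fDx; rewrite linear_sum; apply: eq_bigr => i _; apply: fDx.
Qed.

(** * Operators $f(\partial_y)$ and logarithmic derivatives *)

Definition fpsC (K : fieldType) (f : fps K) : fps {mpoly K[3]} :=
  fun n => (f n)%:MP_[3].

Lemma fpsC_mul (K : fieldType) (f g : fps K) :
  fpsC (fps_mul f g) =1 fps_mul (fpsC f) (fpsC g).
Proof.
by move=> n; rewrite /fpsC raddf_sum; apply: eq_bigr => i _; rewrite /= mpolyCM.
Qed.

Lemma eq_fps_dy (K : fieldType) (f f' : fps K) (p : {mpoly K[3]}) :
  f =1 f' -> fps_dy f p = fps_dy f' p.
Proof. by move=> eqf; apply: eq_bigr => j _; rewrite eqf. Qed.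

Lemma fps_dyN (K : fieldType) (f : fps K) (p : {mpoly K[3]}) :
  fps_dy (fun n => - f n) p = - fps_dy f p.
Proof. by rewrite -sumrN; apply: eq_bigr => j _; rewrite scaleNr. Qed.

Lemma fps_dyZ (K : fieldType) (f : fps K) (c : K) (p : {mpoly K[3]}) :
  fps_dy f (c *: p) = c *: fps_dy f p.
Proof.
rewrite (fps_dyE f (msizeZ_le p c)) scaler_sumr; apply: eq_bigr => j _.
by rewrite mderivmZ !scalerA mulrC.
Qed.

Lemma M_LHA_AZ (K : fieldType) (m r : nat) (A : fps K) (c : K) (p : {mpoly K[3]}) :
  M_LHA_A m r A (c *: p) = c *: M_LHA_A m r A p.
Proof.
rewrite /M_LHA_A fps_dyZ !mderivmZ linearZ /= -!scalerAr !scalerMnr.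
by rewrite -!scalerDr.
Qed.

(** Differentiating $f \cdot f^{-1} = 1$ gives $f' f^{-1} = -f\,(f^{-1})'$, where $f = 1/f^{-1}$. *)
Lemma logderiv_inv (K : fieldType) (f : fps K) :
  f 0%N != 0 ->
  fps_div (fps_deriv f) f =1
  (fun n => - fps_div (fps_deriv (fps_inv f)) (fps_inv f) n).
Proof.
move=> f0 n; have derD := fps_deriv_derivation K^o.
have [Dloc _ DM] := derD.
have inv_deriv : fps_mul (fps_deriv f) (fps_inv f) n
    = - fps_mul f (fps_deriv (fps_inv f)) n.
  apply/eqP; rewrite -addr_eq0; apply/eqP; rewrite -[LHS]DM.
  by rewrite (Dloc _ _ n (fun i _ => fps_mulV f0 i)) (derivation_one derD).
rewrite /fps_div inv_deriv; congr (- _); rewrite fps_mulC; apply: eq_fps_mul => // i.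
by rewrite fps_invK.
Qed.

(** * Differential relations of the generating function *)

Section GeneratingFunction.

Variables (K : numFieldType) (m r : nat) (A : fps K).
Hypotheses (m_gt0 : (1 <= m)%N) (r_gt0 : (1 <= r)%N).

Let bessel : fps {mpoly K[3]} :=
  fps_comp (@bessel_tricomi0 K) (fps_mono (- 'X_ix) m).

(** A sum of two monomial series also covers $r = 1$, where both lie in degree one. *)
Let phase : fps {mpoly K[3]} :=
  fun n => fps_mono 'X_iy 1 n + fps_mono 'X_iz r n.

Let ker : fps {mpoly K[3]} := fps_comp (@exp_fps K) phase.

Let LHA_genE : LHA_gen m r A = fps_mul (fps_mul (fpsC A) bessel) ker.
Proof. by []. Qed.

Let phase0 : phase 0%N = 0.
Proof. by rewrite /phase /fps_mono (ltn_eqF r_gt0) addr0. Qed.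

(** The signs of $C_0$ and of $(-x)^k$ cancel, leaving $\sum_q x^q t^{qm}/(q!)^2$. *)
Let besselE (n : nat) : bessel n =
  if (m %| n)%N then (((n %/ m)`!)%:R ^+ 2)^-1 *: 'X_ix ^+ (n %/ m)%N else 0.
Proof.
rewrite /bessel /fps_comp; under eq_bigr do rewrite fps_exp_mono.
case: ifP => [/dvdnP[q ->] | n_ndvd]; last first.
  rewrite big1 // => k _; rewrite ifN ?scaler0 //.
  by apply: contraFN n_ndvd => /eqP->; apply: dvdn_mull.
rewrite mulnK // (bigD1 (inord q)) //= inordK ?ltnS ?leq_pmulr // eqxx.
rewrite big1 ?addr0 => [|k ne_kq].
  rewrite -scaleN1r exprZn scalerA /bessel_tricomi0 mulrAC -exprMn mulrNN mulr1.
  by rewrite expr1n mul1r.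
rewrite ifN ?scaler0 // eqn_pmul2r //; apply: contra ne_kq => /eqP def_q.
by apply/eqP/val_inj; rewrite /= inordK ?ltnS ?leq_pmulr.
Qed.

(** Rests on $(k+1)m/((k+1)!)^2 = m/((k+1)(k!)^2)$, where $1/(k+1)$ is the factor that $D_x^{-1}$
    puts on $x^k$. *)
Let bessel_deriv :
  fps_deriv bessel =1
  fps_mul (fps_mono m%:R m.-1) (fun n => Dxinv (bessel n)).
Proof.
move=> n; rewrite fps_mul_mono /fps_deriv !besselE.
(* If $m$ does not divide $n+1$, it does not divide $n-(m-1)$ either when $m-1 \le n$, and both
   sides vanish. *)
have [/dvdnP[k def_n] | n_ndvd] := boolP (m %| n.+1)%N; last first.
  rewrite mul0rn; case: leqP => // le_mn; rewrite ifN ?linear0 ?mulr0 //.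
  apply: contra n_ndvd => m_dvd; rewrite -(subnK le_mn) -addnS prednK //.
  by rewrite dvdn_addl.
case: k def_n => [//|k] def_n.
have def_km : (n - m.-1)%N = (k * m)%N.
  by rewrite -subSS prednK // def_n mulSn addKn.
have le_mn : (m.-1 <= n)%N by rewrite -ltnS prednK // def_n mulSn leq_addr.
rewrite le_mn def_km dvdn_mull // def_n !mulnK // linearZ /= !mpolyXn DxinvX.
rewrite -scaler_nat scalerA -[m%:R]mpolyC_nat mul_mpolyC !scalerA.
rewrite mulmnE mnm1E eqxx mul1n.  congr (_ *: 'X_[_]); last first.
  by rewrite mulmS addmC.
rewrite factS !natrM; field.
by rewrite nat1r !pnatr_eq0 -!lt0n fact_gt0.
Qed.

(** Only the exponential depends on $y$, and its exponent has $y$-derivative $t$; the zero case is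
    the missing constant term of $t$ times the generating function. *)
Lemma LHA_gen_mderiv (n : nat) :
  (LHA_gen m r A n)^`M(iy) = if (1 <= n)%N then LHA_gen m r A n.-1 else 0.
Proof.
pose D (f : fps {mpoly K[3]}) k := (f k)^`M(iy).
have derD : fps_derivation D by apply: mderiv_derivation.
have [_ _ DM] := derD.
have DA0 : D (fpsC A) =1 (fun=> 0) by move=> k; apply: mderivC.
have Dbessel0 : D bessel =1 (fun=> 0).
  move=> k; rewrite /D besselE; case: ifP => _; last exact: mderiv0.
  by rewrite mderivZ mpolyXn mderivX mulmnE mnm1E mul0n scale0r scaler0.
have Dphase : D phase =1 fps_mono 1 1.
  move=> k; rewrite /D mderivD /fps_mono.
  have DX i : ('X_i : {mpoly K[3]})^`M(iy) = (i == iy)%:R.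
    rewrite mderivX mnm1E; case: eqP => [->|_]; last by rewrite scale0r.
    by rewrite -{1}[U_(iy)%MM]add0m addmK mpolyX0 scale1r.
  by do 2![case: ifP => _]; rewrite ?DX ?mderiv0 ?addr0.
rewrite -[LHS]/(D (LHA_gen m r A) n) LHA_genE DM fps_mul0 => [|k]; last first.
  by rewrite DM fps_mul0 // fps_mulr0 // addr0.
rewrite add0r (eq_fps_mul (frefl _) (derivation_comp_exp derD phase0)) fps_mulCA.
by rewrite (eq_fps_mul Dphase (frefl _)) fps_mul_mono mul1r subn1.
Qed.

Lemma LHA_gen_dy (n j : nat) :
  (LHA_gen m r A n)^`M(iy, j) = if (j <= n)%N then LHA_gen m r A (n - j)%N else 0.
Proof.
elim: j => [|j IHj]; first by rewrite mderivn0 subn0.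
rewrite mderivnS IHj; case: (leqP j n) => [le_jn | lt_nj].
  by rewrite LHA_gen_mderiv subn_gt0 subnS.
by rewrite mderiv0 ltnNge (ltnW lt_nj).
Qed.

Lemma fps_dy_LHA_gen (f : fps K) (n : nat) :
  fps_dy f (LHA_gen m r A n) = fps_mul (fpsC f) (LHA_gen m r A) n.
Proof.
(* One sum is bounded by [msize], the other by $n+1$; both are extended to the larger bound. *)
rewrite (fps_dyE f (leq_maxl _ n.+1)); set N := maxn _ _.
have ltnN : (n < N)%N by apply: leq_maxr.
under eq_bigr do rewrite LHA_gen_dy.
rewrite /fps_mul [RHS](big_ord_widen _ (fun j => fpsC f j * LHA_gen m r A (n - j)%N) ltnN).
rewrite [RHS]big_mkcond; apply: eq_bigr => j _.
by rewrite ltnS; case: ifP; rewrite ?scaler0 // mul_mpolyC.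
Qed.

Let Dxinv_LHA_gen :
  (fun n => Dxinv (LHA_gen m r A n)) =1
  fps_mul ker (fps_mul (fpsC A) (fun n => Dxinv (bessel n))).
Proof.
have kerDx n : Dxinv_commutes (ker n).
  apply: Dxinv_commutes_comp => k p; rewrite mulrDl linearD mulrDl /fps_mono.
  congr (_ + _); case: ifP => _; rewrite ?mul0r ?linear0 //; exact: DxinvMX.
(* The exponential moves to the front because [Dxinv_fps_mul] releases left factors. *)
move=> n; rewrite LHA_genE fps_mulC Dxinv_fps_mul //.
apply: eq_fps_mul => // k; rewrite Dxinv_fps_mul // => i; exact: Dxinv_commutesC.
Qed.

Let phase_deriv :
  fps_deriv phase =1 (fun n => fps_mono 'X_iy 0 n + fps_mono ('X_iz *+ r) r.-1 n).
Proof.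
move=> n; rewrite /fps_deriv mulrnDl /fps_mono eqSS; congr (_ + _).
  by case: eqP => [->|_]; rewrite ?mul0rn.
rewrite -{1}(prednK r_gt0) eqSS; case: eqP => [->|_]; last by rewrite mul0rn.
by rewrite prednK.
Qed.

Lemma M_LHA_gen (n : nat) :
  A 0%N != 0 -> M_LHA_A m r A (LHA_gen m r A n) = LHA_gen m r A n.+1 *+ n.+1.
Proof.
move=> A0; have derD := fps_deriv_derivation {mpoly K[3]}.
have [_ _ DM] := derD.
have DfpsC : fps_deriv (fpsC A) =1 fps_mul (fpsC (fps_div (fps_deriv A) A)) (fpsC A).
  by move=> k; rewrite -fpsC_mul /fpsC fps_divK // /fps_deriv -mpolyCMn.
rewrite -[RHS]/(fps_deriv (LHA_gen m r A) n) LHA_genE DM.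
rewrite (eq_fps_mul (DM (fpsC A) bessel) (frefl ker)) fps_mulDl.
rewrite (eq_fps_mul (frefl _) (derivation_comp_exp derD phase0)) fps_mulCA.
rewrite (eq_fps_mul phase_deriv (frefl _)) fps_mulDl !fps_mul_mono subn0 leq0n.
(* The term $A'BE$ is $A'/A$ times the generating function, hence $(A'/A)(\partial_y)$ applied to
   it. *)
have -> : fps_mul (fps_mul (fps_deriv (fpsC A)) bessel) ker n =
          fps_dy (fps_div (fps_deriv A) A) (LHA_gen m r A n).
  rewrite fps_dy_LHA_gen LHA_genE fps_mulA; apply: eq_fps_mul => // k.
  by rewrite fps_mulA; apply: eq_fps_mul.
(* In $AB'E$ the factor $mt^{m-1}$ comes out, leaving $D_x^{-1}$ of the whole series. *)
have -> : fps_mul (fps_mul (fpsC A) (fps_deriv bessel)) ker n =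
          fps_mul (fps_mono m%:R m.-1) (fun k => Dxinv (LHA_gen m r A k)) n.
  rewrite (eq_fps_mul (frefl _) Dxinv_LHA_gen) fps_mulCA fps_mulC.
  apply: eq_fps_mul => // k; rewrite fps_mulCA; exact: eq_fps_mul.
rewrite fps_mul_mono /M_LHA_A !LHA_gen_dy -!LHA_genE.
(* Summands are put in the order of [M_LHA_A]; the case splits concern $n < m-1$ and $n < r-1$,
   where the $y$-derivatives vanish. *)
rewrite [RHS]addrC [X in _ = _ + X]addrC [RHS]addrA [X in _ = X + _]addrAC.
congr (_ + _ + _ + _).
  by case: ifP; rewrite ?linear0 ?mul0rn // mulr_natl.
by case: ifP; rewrite ?mulr0 ?mul0rn // mulrnAl.
Qed.

End GeneratingFunction.

(** * Quasi-monomiality *)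

Theorem theorem2p2 (K : numFieldType) (m r : nat) (hm : (1 <= m)%N)
    (hr : (1 <= r)%N) (g : nat -> K) (hg : g 0%N != 0) :
  let G : fps K := egf g in
  let A : fps K := fps_inv G in
  quasi_monomial (LHA m r A) (M_LHA_g m r G) (@P_LHA K)
  /\ quasi_monomial (LHA m r A) (M_LHA_A m r A) (@P_LHA K)
  /\ (forall p : {mpoly K[3]}, M_LHA_g m r G p = M_LHA_A m r A p).
Proof.
move=> G A.
have G0 : G 0%N != 0 by rewrite /G /egf divr1.
have A0 : A 0%N != 0 by apply: fps_inv_neq0.
(* Since $A = 1/g$, $-g'/g = A'/A$; the raising relation is then proved for the second form only. *)
have M_eq p : M_LHA_g m r G p = M_LHA_A m r A p.
  by rewrite /M_LHA_g (eq_fps_dy _ (logderiv_inv G0)) fps_dyN opprK.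
have P_LHA_n n : (1 <= n)%N -> P_LHA (LHA m r A n) = LHA m r A n.-1 *+ n.
  case: n => // n _; rewrite /P_LHA /LHA mderivZ LHA_gen_mderiv //=.
  by rewrite factS natrM -scalerA scaler_nat.
(* The factor $n+1$ from $d/dt$ turns the normalisation $n!$ into $(n+1)!$. *)
have M_LHA_n n : M_LHA_A m r A (LHA m r A n) = LHA m r A n.+1.
  rewrite /LHA M_LHA_AZ M_LHA_gen // -scaler_nat scalerA factS natrM.
  by rewrite mulrC.
by split; first split=> // n; rewrite ?M_eq.
Qed.
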